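(* Let $H$ be a Hamiltonian on a finite-dimensional Hilbert space, $\ket\Psi=\sum_jc_j\ket{E_j}$ an initial state, and $A$ an observable with matrix elements $A_{ij}$ such that $\langle A(t)\rangle=\sum_{i,j}c_ic_j^*A_{ij}e^{-i(E_i-E_j)t}=\sum_\omega v_\omega e^{-i\omega t}$, where $v_\omega=\sum_{i,j:\,E_i-E_j=\omega}c_ic_j^*A_{ij}$. Let $\tau>0$ and suppose that (1) the expectation value is periodic: $\langle A(t)\rangle=\langle A(t+\tau)\rangle$ for all $t$; (2) for every $\omega$, $v_\omega=0$ implies $c_ic_j^*=0$ for all $i,j$ with $E_i-E_j=\omega$. Then $c_ic_j^*\ne0$ only if $E_i-E_j=2\pi l/\tau$ for some integer $l$, and consequently $F(\tau)=F(0)$.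
   Context: $\ket{E_j}$ are orthonormal energy eigenstates with energies $E_j$; in degenerate eigenspaces the basis is chosen so that each energy appears only once in the decomposition of $\ket\Psi$. $\ket{\Psi(t)}=e^{-itH}\ket\Psi$, $\langle A(t)\rangle=\bra{\Psi(t)}A\ket{\Psi(t)}$, and $A_{ij}=\bra{E_j}A\ket{E_i}$. $F(t)=|\bra\Psi e^{-itH}\ket\Psi|$, so $F(0)=1$. $\hbar=1$. *)

(* Defs.v *)
From HB Require Import structures.
From mathcomp Require Import all_boot all_order all_algebra.
From mathcomp Require Import complex.
From mathcomp Require Import all_classical all_reals all_analysis.
Set Implicit Arguments.
Unset Strict Implicit.
Unset Printing Implicit Defensive.
Import Order.TTheory GRing.Theory Num.Theory.
Import numFieldNormedType.Exports.
Local Open Scope classical_set_scope.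
Local Open Scope ring_scope.
Local Open Scope complex_scope.
Local Open Scope sesquilinear_scope.

(* The n-dimensional Hilbert space is C^n (column vectors over R[i]) with its
   standard inner product, antilinear in the left argument. *)
Definition braket (R : realType) (n : nat) (u v : 'cV[R[i]]_n) : R[i] :=
  (u ^t* *m v) 0 0.

(* Sum of the series M^k / k!, for the normed topology of complex matrices. *)
Definition expmx (R : realType) (n : nat) (M : 'M[R[i]]_n) : 'M[R[i]]_n :=
  limn (series (fun k : nat => (k`!%:R)^-1 *: M ^+ k)).

Definition evolve (R : realType) (n : nat) (H : 'M[R[i]]_n) (t : R)
    (psi : 'cV[R[i]]_n) : 'cV[R[i]]_n :=
  expmx (- ('i%C * t%:C) *: H) *m psi.

Definition expect (R : realType) (n : nat) (H A : 'M[R[i]]_n)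
    (psi : 'cV[R[i]]_n) (t : R) : R[i] :=
  braket (evolve H t psi) (A *m evolve H t psi).

(* The modulus of R[i] takes its values in R[i], on the nonnegative reals. *)
Definition fidelity (R : realType) (n : nat) (H : 'M[R[i]]_n)
    (psi : 'cV[R[i]]_n) (t : R) : R[i] :=
  `| braket psi (evolve H t psi) |.

Definition orthonormal_family (R : realType) (n : nat)
    (e : 'I_n -> 'cV[R[i]]_n) : Prop :=
  forall i j : 'I_n, braket (e i) (e j) = (i == j)%:R.

(* Note the order of the indices: A_ij = <E_j|A|E_i>. *)
Definition matelt (R : realType) (n : nat) (e : 'I_n -> 'cV[R[i]]_n)
    (A : 'M[R[i]]_n) (i j : 'I_n) : R[i] :=
  braket (e j) (A *m e i).

(* The amplitude of e^(-i omega t) in the expansion of <A(t)>. *)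
Definition freq_amp (R : realType) (n : nat) (e : 'I_n -> 'cV[R[i]]_n)
    (E : 'I_n -> R) (c : 'I_n -> R[i]) (A : 'M[R[i]]_n) (omega : R) : R[i] :=
  \sum_(i < n) \sum_(j < n | E i - E j == omega)
    c i * (c j)^* * matelt e A i j.

(* Main.v *)
Require Import Defs.
From HB Require Import structures.
From mathcomp Require Import all_boot all_order all_algebra.
From mathcomp Require Import complex.
From mathcomp Require Import all_classical all_reals all_analysis.
From mathcomp Require Import ring.
Import Order.TTheory GRing.Theory Num.Theory.
Import numFieldNormedType.Exports.
Local Open Scope ring_scope.
Local Open Scope complex_scope.
Local Open Scope sesquilinear_scope.

(* Distinct characters t |-> e^(-i omega t) are linearly independent, so
   periodicity, read as
     sum_omega v_omega (1 - e^(-i omega tau)) e^(-i omega t) = 0 for all t,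
   forces v_omega (1 - e^(-i omega tau)) = 0 for each omega; the no-cancellation
   hypothesis then gives e^(-i omega tau) = 1 at every gap omega = E_i - E_j with
   c_i c_j^* <> 0. Hence all the energies occurring in psi acquire the same phase
   at time tau, and psi returns to itself up to that phase. *)

(* Dedekind's argument: subtracting chi_j(u) times the relation at x from the
   relation at u + x eliminates chi_j. *)
Lemma independent_characters (V : nmodType) (K : idomainType) (I : eqType)
    (chi : I -> V -> K) (chi0 : forall i, chi i 0 = 1)
    (chiD : forall i x y, chi i (x + y) = chi i x * chi i y)
    (chi_inj : forall i j, chi i =1 chi j -> i = j)
    (s : seq I) (a : I -> K) :
  uniq s -> (forall x, \sum_(i <- s) a i * chi i x = 0) ->
  forall i, i \in s -> a i = 0.
Proof.
elim: s a => [|j s IHs] a //= /andP[js us] sum0.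
have a0 i : i \in s -> a i = 0.
  move=> si; have [//|ai0] := eqVneq (a i) 0.
  (* A nonzero [a i] would force [chi i u = chi j u] for every [u], hence [i = j], which contradicts
     [j] not lying in [s]. *)
  have ij : i = j.
    apply: chi_inj => u; apply/eqP; rewrite -subr_eq0.
    suff /eqP : a i * (chi i u - chi j u) = 0.
      by rewrite mulf_eq0 (negbTE ai0).
    apply: (IHs (fun i => a i * (chi i u - chi j u))) => // x.
    have := sum0 (u + x); rewrite big_cons.
    move=> /(canRL (addKr _)); rewrite addr0 => sum_ux.
    have := sum0 x; rewrite big_cons.
    move=> /(canRL (addKr _)); rewrite addr0 => sum_x.
    transitivity (\sum_(k <- s) a k * chi k (u + x) -
                  chi j u * (\sum_(k <- s) a k * chi k x)).
      rewrite big_distrr -sumrB; apply: eq_bigr => k _ /=.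
      by rewrite chiD mulrBr mulrBl mulrA [chi j u * _]mulrCA mulrA.
    by rewrite sum_ux sum_x chiD mulrN opprK mulrCA addNr.
  by move: js; rewrite -ij si.
move=> i; rewrite inE => /orP[/eqP->|/a0//].
have := sum0 0; rewrite big_cons chi0 mulr1 big1_seq ?addr0// => k.
by move=> /andP[_ /a0->]; rewrite mul0r.
Qed.

(** Several indices may carry the same character, as pairs of levels sharing a gap do. Grouping
    terms over the distinct values of [f] reduces to the previous lemma; off the image of [f] the
    fiber is empty. *)
Lemma independent_characters_fiber (V : nmodType) (K : idomainType)
    (I : eqType) (chi : I -> V -> K) (chi0 : forall i, chi i 0 = 1)
    (chiD : forall i x y, chi i (x + y) = chi i x * chi i y)
    (chi_inj : forall i j, chi i =1 chi j -> i = j)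
    (T : finType) (f : T -> I) (a : T -> K) :
  (forall x, \sum_k a k * chi (f k) x = 0) ->
  forall i, \sum_(k | f k == i) a k = 0.
Proof.
move=> sum0 i; pose s := undup [seq f k | k : T].
have fs k : f k \in s by rewrite mem_undup map_f ?mem_enum.
have [si|si] := boolP (i \in s); last first.
  by rewrite big1// => k /eqP fk; move: si; rewrite -fk fs.
move: i si; apply: (independent_characters _ _ _ _ chi0 chiD chi_inj).
  exact: undup_uniq.
move=> x; rewrite -[RHS](sum0 x).
transitivity (\sum_(i <- s) \sum_(k | f k == i) a k * chi (f k) x).
  apply: eq_bigr => i _; rewrite big_distrl /=.
  by apply: eq_bigr => k /eqP->.
rewrite (exchange_big_dep predT)//=; apply: eq_bigr => k _.
rewrite big_mkcond (bigD1_seq (f k)) ?undup_uniq//= eqxx big1 ?addr0// => i.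
by rewrite eq_sym => /negbTE->.
Qed.

(** * The unit-circle exponential and its period *)

Definition cis {R : realType} (x : R) : R[i] := (cos x +i* sin x)%C.

Section cis.
Variable R : realType.
Implicit Types x y : R.

Lemma cis0 : cis (0 : R) = 1.
Proof. by rewrite /cis cos0 sin0. Qed.

Lemma cisD x y : cis (x + y) = cis x * cis y.
Proof.
rewrite /cis cosD sinD; apply/eqP; rewrite eq_complex /= eqxx /=.
by rewrite addrC [sin x * _]mulrC [cos x * sin y]mulrC eqxx.
Qed.

Lemma conj_cis x : Num.conj (cis x) = cis (- x).
Proof. by rewrite /cis cosN sinN. Qed.

Lemma norm_cis x : `|cis x| = 1.
Proof. by rewrite normc_def /= cos2Dsin2 sqrtr1. Qed.

Lemma cis_pi : cis (pi : R) = - 1.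
Proof.
by rewrite /cis cospi sinpi; apply/eqP; rewrite eq_complex /= oppr0 !eqxx.
Qed.

Lemma cis_intmul (l : int) : cis (2 * pi * l%:~R : R) = 1.
Proof.
have cisn n : cis (2 * pi * n%:R : R) = 1.
  elim: n => [|n IHn]; first by rewrite mulr0 cis0.
  rewrite -[n.+1]addn1 natrD mulrDr mulr1 cisD IHn mul1r mulr_natl mulr2n cisD cis_pi.
  by rewrite mulrNN mulr1.
case: l => n; first exact: cisn.
by rewrite NegzE rmorphN /= mulrN -conj_cis cisn rmorph1.
Qed.

(** Removing whole turns with the floor leaves [y] in [0, 2 pi) with cosine 1. Cosine is injective
    only on [0, pi], so a remainder beyond pi is reflected to [2 * pi - y], which would then vanish,
    against [y < 2 * pi]. *)
Lemma cis_eq1 x : cis x = 1 -> exists l : int, x = 2 * pi * l%:~R.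
Proof.
have pi2_gt0 : 0 < 2 * pi :> R by rewrite mulr_gt0// pi_gt0.
move=> cisx; exists (Num.floor (x / (2 * pi))).
have /andP[floor_le floor_gt] := floor_itv (x / (2 * pi)).
set l := Num.floor _ in floor_le floor_gt *; pose y := x - 2 * pi * l%:~R.
apply/eqP; rewrite -subr_eq0 -/y.
have cosy : cos y = 1.
  have : cis y = 1 by rewrite /y cisD cisx mul1r -mulrN -rmorphN cis_intmul.
  by case.
have y_ge0 : 0 <= y.
  by rewrite subr_ge0 mulrC -ler_pdivlMr.
have y_lt : y < 2 * pi.
  have -> : 2 * pi = (l%:~R + 1) * (2 * pi) - 2 * pi * l%:~R :> R by ring.
  rewrite ltrD2r -ltr_pdivrMr//.
  by move: floor_gt; rewrite intrD.
have zero_itv : (0 : R) \in `[0, pi] by rewrite in_itv /= lexx pi_ge0.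
have [y_le|y_gt] := leP y pi.
  by apply/eqP/cos_inj => //; rewrite ?in_itv /= ?y_ge0// cos0.
have : 2 * pi - y = 0.
  apply: cos_inj => //.
    rewrite in_itv /= subr_ge0 ltW//= lerBlDr mulr_natl mulr2n lerD2l.
    exact: ltW.
  by rewrite cos0 addrC mulr_natl cosD2pi cosN.
by move/eqP; rewrite subr_eq0 gt_eqF.
Qed.

Lemma cis_freq_inj x y :
  (fun t => cis (x * t)) =1 (fun t => cis (y * t)) -> x = y.
Proof.
move=> xy; apply/eqP; rewrite -subr_eq0; apply/negP => /negP d0.
(* At [t = pi / (x - y)] the two characters differ by the factor [cis pi = - 1]. *)
have : cis ((x - y) * (pi / (x - y))) = 1.
  by rewrite mulrBl cisD xy -cisD subrr cis0.
rewrite mulrC divfK// cis_pi => /eqP; rewrite eq_sym -subr_eq0 opprK.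
by rewrite -[1 + 1]/(2%:R) pnatr_eq0.
Qed.

End cis.

(** * The exponential series at imaginary arguments *)

Section complex_limits.
Variable R : realType.

(* The type R[i] by itself carries no topology that unification can find: the
   one used for matrices over R[i] is reached through the alias R[i]^o. *)
Lemma cvg_complex (u v : nat -> R) (a b : R) :
  (u n @[n --> \oo] --> a)%classic -> (v n @[n --> \oo] --> b)%classic ->
  (((u n +i* v n)%C : R[i]^o) @[n --> \oo] --> ((a +i* b)%C : R[i]^o))%classic.
Proof.
move=> /cvgrPdist_lt ua /cvgrPdist_lt vb; apply/cvgrPdist_lt => eps.
case: eps => [e e'] e_gt0.
(* Positivity in the order of [R[i]] forces a zero imaginary part, so the tolerance is real. *)
have /andP[/eqP e'0 {}e_gt0] : (e' == 0) && (0 < e).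
  by move: e_gt0; rewrite ltcE.
have e2_gt0 : 0 < e / 2 by rewrite divr_gt0.
near=> n.
have -> : (a +i* b)%C - (u n +i* v n)%C
    = (a - u n)%:C + 'i%C * (b - v n)%:C :> R[i].
  by rewrite [LHS]complexE.
apply: le_lt_trans (ler_normD _ _) _.
have normR (x : R) : `|x%:C : R[i]| = `|x|%:C.
  by rewrite normc_def /= expr0n addr0 sqrtr_sqr.
rewrite normrM !normR.
have -> : `|'i%C : R[i]| = 1 by rewrite normc_def /= expr0n add0r expr1n sqrtr1.
rewrite mul1r -rmorphD e'0 complexr0 ltcR [e]splitr.
by apply: ltrD; near: n; [exact: ua|exact: vb].
Unshelve. all: by end_near. Qed.

(** Shaped to match [cos_coeff] and [sin_coeff] term by term. At [k = 0] the truncated [k.-1] is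
    harmless, its parity factor being 0. *)
Lemma complex_i_exp k : ('i%C : R[i]) ^+ k =
  (((~~ odd k)%:R * (-1) ^+ k./2) +i* ((odd k)%:R * (-1) ^+ k.-1./2))%C.
Proof.
elim: k => [|k IHk]; first by rewrite expr0 mul1r mul0r.
rewrite exprS IHk; apply/eqP; rewrite eq_complex /= !mul0r !mul1r !add0r.
case: k {IHk} => [|k]; first by rewrite /= !mul0r oppr0 !mul1r !eqxx.
by rewrite /= negbK exprS mulN1r mulrN !eqxx.
Qed.

Lemma cis_coeffE (x : R) k : (k`!%:R)^-1 * ('i%C * x%:C) ^+ k =
  ((cos_coeff x k) +i* (sin_coeff x k))%C.
Proof.
rewrite exprMn complex_i_exp -rmorphXn /= /cos_coeff /sin_coeff /=.
have -> : (k`!%:R : R[i])^-1 = (k`!%:R^-1)%:C by rewrite fmorphV rmorph_nat.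
apply/eqP; rewrite eq_complex /= !mul0r !mulr0 !subr0 !addr0 !add0r.
by rewrite ![_^-1 * _]mulrC !eqxx.
Qed.

Lemma cvg_cis_series (x : R) :
  (series (fun k => (k`!%:R)^-1 * ('i%C * x%:C) ^+ k) n @[n --> \oo]
     --> (cis x : R[i]^o))%classic.
Proof.
have -> : series (fun k => (k`!%:R)^-1 * ('i%C * x%:C : R[i]) ^+ k) =
    fun n => ((series (cos_coeff x) n) +i* (series (sin_coeff x) n))%C.
  apply/funext => n; rewrite /series /=; elim: n => [|n IHn].
    by rewrite !big_geq.
  by rewrite !big_nat_recr //= IHn cis_coeffE.
apply: cvg_complex.
  rewrite unlock; exact: is_cvg_series_cos_coeff.
rewrite unlock; exact: is_cvg_series_sin_coeff.
Qed.

End complex_limits.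

(** * Sesquilinearity of the inner product *)

Section braket.
Variables (R : realType) (n : nat).
Implicit Types (u v : 'cV[R[i]]_n) (a : R[i]).

Lemma braketZr a u v : braket u (a *: v) = a * braket u v.
Proof. by rewrite /braket -scalemxAr mxE. Qed.

Lemma braketZl a u v : braket (a *: u) v = Num.conj a * braket u v.
Proof. by rewrite /braket linearZ /= map_mxZ -scalemxAl mxE. Qed.

Lemma braket_sumr (I : finType) u (f : I -> 'cV[R[i]]_n) :
  braket u (\sum_i f i) = \sum_i braket u (f i).
Proof. by rewrite /braket mulmx_sumr summxE. Qed.

Lemma braket_suml (I : finType) (f : I -> 'cV[R[i]]_n) v :
  braket (\sum_i f i) v = \sum_i braket (f i) v.
Proof.
rewrite /braket -summxE -mulmx_suml; congr ((_ *m _) 0 0).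
by rewrite linear_sum /= map_mx_sum.
Qed.

End braket.

(** * Evolution and expectation in the energy eigenbasis *)

Section spectral_expansion.
Variables (R : realType) (n : nat) (e : 'I_n -> 'cV[R[i]]_n).
Hypothesis e_orthonormal : orthonormal_family e.

(** With the vectors as columns of a square [U], orthonormality says that [U] has its adjoint as
    left inverse, which is then also a right inverse. *)
Lemma orthonormal_resolution : \sum_l e l *m (e l)^t* = 1%:M.
Proof.
pose U := \matrix_(i < n, j < n) e j i 0.
have UU : U^t* *m U = 1%:M.
  apply/matrixP => i j; rewrite [RHS]mxE -e_orthonormal /braket !mxE.
  by apply: eq_bigr => k _; rewrite !mxE.
rewrite -(mulmx1C UU); apply/matrixP => i j; rewrite summxE mxE.
by apply: eq_bigr => l _; rewrite !mxE big_ord1 !mxE.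
Qed.

(** Powers of [M] are combinations of the fixed projectors [P l], so the matrix series is a finite
    sum of scalar series times constant matrices and its limit is taken termwise. *)
Lemma expmx_eigen (M : 'M[R[i]]_n) (d z : 'I_n -> R[i])
    (M_eigen : forall l, M *m e l = d l *: e l)
    (z_exp : forall l, (series (fun k => (k`!%:R)^-1 * d l ^+ k) m
                          @[m --> \oo] --> (z l : R[i]^o))%classic) l :
  expmx M *m e l = z l *: e l.
Proof.
pose P l := e l *m (e l)^t*.
have powP k l' : M ^+ k *m P l' = d l' ^+ k *: P l'.
  elim: k => [|k IHk]; first by rewrite expr0 scale1r mul1mx.
  rewrite !exprS -mulmxE -mulmxA IHk -scalemxAr mulmxA M_eigen -scalemxAl.
  by rewrite scalerA mulrC.
have powE k : M ^+ k = \sum_l' d l' ^+ k *: P l'.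
  rewrite -[LHS]mulmx1 -orthonormal_resolution mulmx_sumr.
  by apply: eq_bigr => l' _; exact: powP.
have -> : expmx M = \sum_l' z l' *: P l'.
  apply: (@cvg_lim ('M[R[i]]_n : normedModType R[i])).
    exact: norm_hausdorff.
  have -> : series (fun k => (k`!%:R)^-1 *: M ^+ k) =
      fun m => \sum_l' series (fun k => (k`!%:R)^-1 * d l' ^+ k) m *: P l'.
    apply/funext => m; rewrite /series /=.
    under [RHS]eq_bigr do rewrite scaler_suml.
    rewrite exchange_big /=; apply: eq_bigr => k _.
    by rewrite powE scaler_sumr; apply: eq_bigr => l' _; rewrite scalerA.
  apply: cvg_big => [|l' _]; first exact: add_continuous.
  exact: cvgZr_tmp.
rewrite mulmx_suml (bigD1 l)//= big1 => [|j jl].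
  rewrite addr0 -scalemxAl -mulmxA [X in _ *m X]mx11_scalar.
  by rewrite -/(braket _ _) e_orthonormal eqxx mulmx1.
rewrite -scalemxAl -mulmxA [X in _ *m X]mx11_scalar.
by rewrite -/(braket _ _) e_orthonormal (negbTE jl) raddf0 mulmx0 scaler0.
Qed.

Variables (H : 'M[R[i]]_n) (E : 'I_n -> R).
Hypothesis e_eigen : forall j, H *m e j = (E j)%:C *: e j.

Lemma evolve_sum (c : 'I_n -> R[i]) (t : R) :
  evolve H t (\sum_j c j *: e j) = \sum_j (c j * cis (- (E j * t))) *: e j.
Proof.
rewrite /evolve mulmx_sumr; apply: eq_bigr => j _.
rewrite -scalemxAr -scalerA; congr (_ *: _).
apply: (expmx_eigen _ (fun l => 'i%C * (- (E l * t))%:C)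
                    (fun l => cis (- (E l * t)))) => l.
  rewrite -scalemxAl e_eigen scalerA; congr (_ *: _).
  by rewrite rmorphN rmorphM /= mulrN mulNr -mulrA [t%:C * _]mulrC.
exact: cvg_cis_series.
Qed.

Lemma expect_sum (A : 'M[R[i]]_n) (c : 'I_n -> R[i]) (t : R) :
  expect H A (\sum_j c j *: e j) t =
  \sum_i \sum_j c i * (c j)^* * matelt e A i j * cis (- ((E i - E j) * t)).
Proof.
rewrite /expect evolve_sum mulmx_sumr braket_sumr.
apply: eq_bigr => i _; rewrite braket_suml; apply: eq_bigr => j _.
rewrite braketZl -scalemxAr braketZr -/(matelt e A i j) rmorphM /= conj_cis.
rewrite opprK mulrBl opprB cisD; ring.
Qed.

End spectral_expansion.

Theorem mainTheorem7 (R : realType) (n : nat)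
    (H A : 'M[R[i]]_n) (psi : 'cV[R[i]]_n)
    (e : 'I_n -> 'cV[R[i]]_n) (E : 'I_n -> R) (c : 'I_n -> R[i]) (tau : R)
    (H_herm : H \is hermsymmx)
    (A_herm : A \is hermsymmx)
    (e_orthonormal : orthonormal_family e)
    (e_eigen : forall j : 'I_n, H *m e j = (E j)%:C *: e j)
    (psi_state : braket psi psi = 1)
    (psi_decomp : psi = \sum_(j < n) c j *: e j)
    (energy_once : forall i j : 'I_n,
       c i != 0 -> c j != 0 -> E i = E j -> i = j)
    (tau_gt0 : 0 < tau)
    (periodic : forall t : R, expect H A psi t = expect H A psi (t + tau))
    (no_cancel : forall omega : R, freq_amp e E c A omega = 0 ->
       forall i j : 'I_n, E i - E j = omega -> c i * (c j)^* = 0) :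
  (forall i j : 'I_n, c i * (c j)^* != 0 ->
     exists l : int, E i - E j = 2 * pi * l%:~R / tau)
  /\ fidelity H psi tau = fidelity H psi 0.
Proof.
have sum0 (t : R) : \sum_(p : 'I_n * 'I_n)
    (c p.1 * (c p.2)^* * matelt e A p.1 p.2 *
       (1 - cis (- ((E p.1 - E p.2) * tau)))) *
    cis (- (E p.1 - E p.2) * t) = 0.
  have := periodic t; rewrite psi_decomp.
  rewrite !(expect_sum _ _ _ e_orthonormal _ _ e_eigen).
  rewrite !pair_big /= => /eqP; rewrite -subr_eq0 -sumrB.
  move=> /eqP diff0; rewrite -[RHS]diff0.
  by apply: eq_bigr => p _; rewrite -!mulNr [_ * (t + tau)]mulrDr cisD; ring.
have freq0 w : freq_amp e E c A w * (1 - cis (- (w * tau))) = 0.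
  have cis_0 (v : R) : cis (v * 0) = 1 by rewrite mulr0 cis0.
  have cis_D (v x y : R) : cis (v * (x + y)) = cis (v * x) * cis (v * y).
    by rewrite mulrDr cisD.
  (* The fiber is taken at [- w] because [sum0] has characters of frequency [- (E i - E j)]. On it
     the factor [1 - cis (- (w * tau))] is constant and leaves the sum. *)
  have fiber0 := independent_characters_fiber _ _ _ (fun v t => cis (v * t))
    cis_0 cis_D (@cis_freq_inj R) _ _ _ sum0 (- w).
  rewrite -[RHS]fiber0 /freq_amp pair_big_dep /= big_distrl /=.
  by apply: eq_big => [p|p /eqP <-//]; rewrite eqr_opp.
have phase i j : c i * (c j)^* != 0 -> cis ((E i - E j) * tau) = 1.
  move=> cij; have /eqP := freq0 (E i - E j); rewrite mulf_eq0 => /orP[/eqP v0|].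
    by move: cij; rewrite (no_cancel _ v0) ?eqxx.
  rewrite subr_eq0 => /eqP /esym cis1.
  by rewrite -[_ * tau]opprK -conj_cis cis1 rmorph1.
split=> [i j /phase /cis_eq1[l El]|].
  by exists l; rewrite -El mulfK// gt_eqF.
(* A normalised state occupies some level [k], whose phase serves as reference. *)
have [k ck] : exists k, c k != 0.
  apply: contrapT => /forallNP c0; have := psi_state.
  rewrite psi_decomp big1 => [|j _]; last first.
    by have /negP := c0 j; rewrite negbK => /eqP->; rewrite scale0r.
  by rewrite /braket mulmx0 mxE => /esym/eqP; rewrite oner_eq0.
(* Each occupied level [j] has [c k * (c j)^*] nonzero, so [phase] aligns it with level [k]; empty
   levels contribute nothing. *)
have evolve_tau : evolve H tau psi = cis (- (E k * tau)) *: evolve H 0 psi.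
  rewrite psi_decomp !(evolve_sum _ _ _ e_orthonormal _ _ e_eigen) scaler_sumr.
  apply: eq_bigr => j _; rewrite mulr0 oppr0 cis0 mulr1 scalerA.
  have [->|cj] := eqVneq (c j) 0; first by rewrite mul0r mulr0.
  rewrite mulrC; congr (_ * _ *: _).
  have -> : - (E j * tau) = - (E k * tau) + (E k - E j) * tau by ring.
  by rewrite cisD phase ?mulr1// mulf_neq0// conjC_eq0.
by rewrite /fidelity evolve_tau braketZr normrM norm_cis mul1r.
Qed.
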